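(* There exists a function $f$ holomorphic on $\Omega$ such that $f\notin A^2(\Omega)$ and $$\sum_{n=0}^{\infty}\frac{2^n}{(2n+1)!}\int_0^{1/2}x^{2n+1}\big(|f^{(n)}(x)|^2+|f^{(n)}(1-x)|^2\big)dx<\infty.$$
   Context: $D(c,r)$ denotes the open disk in $\mathbb{C}$ of center $c$ and radius $r$, and $$\Omega=\bigcup_{0<x\le 1/2}D\big(x,x/\sqrt2\big)\ \cup\bigcup_{1/2<x<1}D\big(x,(1-x)/\sqrt2\big).$$ The Bergman space $A^2(\Omega)$ is the space of holomorphic functions $f$ on $\Omega$ with $\int_\Omega|f|^2\,dA<\infty$, where $dA=dx\,dy$ is planar Lebesgue measure. *)

(* Defs.v *)
From HB Require Import structures.
From mathcomp Require Import all_boot all_order all_algebra.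
From mathcomp Require Import complex.
From mathcomp Require Import all_classical all_reals all_analysis.

Set Implicit Arguments.
Unset Strict Implicit.
Unset Printing Implicit Defensive.

Import Order.TTheory GRing.Theory Num.Theory.
Import numFieldNormedType.Exports.

Local Open Scope ring_scope.
Local Open Scope classical_set_scope.
Local Open Scope complex_scope.

(* R[i] as a normed space over itself, so that [derivable] and [derive1n] on
   functions R[i] -> R[i] are complex differentiability and iterated complex
   derivatives. *)
HB.instance Definition _ (R : rcfType) := NormedModule.copy R[i] R[i]^o.

(* The modulus as an element of R; the ssrnum norm on R[i] takes values in
   R[i]: `|z| = (cabs z)%:C holds by conversion. *)
Definition cabs (R : realType) (z : R[i]) : R := ComplexField.Normc.normc z.

Definition disk (R : realType) (c : R[i]) (r : R) : set R[i] :=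
  [set z | cabs (z - c) < r].

Definition Omega (R : realType) : set R[i] :=
  (\bigcup_(x in `]0, 2^-1 : R]) disk x%:C (x / Num.sqrt 2))
  `|` (\bigcup_(x in `]2^-1 : R, 1[) disk x%:C ((1 - x) / Num.sqrt 2)).

(* Functions on an open set U are represented by total functions; only the
   values on U are constrained. *)
Definition holomorphic_on (R : realType) (U : set R[i]) (f : R[i] -> R[i]) :
    Prop :=
  forall z, U z -> derivable f z 1.

Definition area (R : realType) :=
  (@lebesgue_measure R \x @lebesgue_measure R)%E.

Definition bergman_space (R : realType) (U : set R[i]) : set (R[i] -> R[i]) :=
  [set f | holomorphic_on U f /\
    (\int[@area R]_(p in [set p : R * R | U (p.1 +i* p.2)])
       (cabs (f (p.1 +i* p.2)) ^+ 2)%:E < +oo)%E].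

(* Main.v *)
(* The function is f(z) = 1/(z - p), where p = 1/2 + i/(2 sqrt 2) is the top of
   the circle bounding the largest disk of Omega.  Near p the boundary of Omega
   is smooth, so |f|^2 ~ 1/|z - p|^2 just fails to be integrable: dyadic boxes
   shrinking to p each contribute at least 1/4.  On the other
   hand |f^(n)(x)|^2 = n!^2 / d^(2n+2) with d^2 = (x - 1/2)^2 + 1/8, and
   x^2/(2 d^2) <= 1/2 + x on ]0, 1/2], so with w_n = 4^n n!^2 / (2n+1)! the n-th
   term of the series is at most 8 w_n / (n+1).  Since
   w_n - w_(n+1) = w_n / (2n+3), these bounds telescope. *)

Require Import Defs.
From mathcomp Require Import all_boot all_order all_algebra.
From mathcomp Require Import complex.
From mathcomp Require Import all_classical all_reals all_analysis.
From mathcomp Require Import measurable_realfun.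
From mathcomp Require Import ring lra zify.

Set Implicit Arguments.
Unset Strict Implicit.
Unset Printing Implicit Defensive.

Import Order.TTheory GRing.Theory Num.Theory.
Import numFieldNormedType.Exports.

Local Open Scope ring_scope.
Local Open Scope classical_set_scope.
Local Open Scope complex_scope.

(** The integral of a nonnegative function is a supremum over the simple functions below its
    extension by zero, and this family grows with the function. *)
Lemma ge0_le_integral_nonmeasurable d (T : measurableType d) (R : realType)
    (mu : {measure set T -> \bar R}) (D E : set T) (f g : T -> \bar R) :
  (forall x, D x -> 0 <= f x)%E -> (forall x, E x -> 0 <= g x)%E ->
  (forall x, (f \_ D) x <= (g \_ E) x)%E ->
  (\int[mu]_(x in D) f x <= \int[mu]_(x in E) g x)%E.
Proof.
move=> f0 g0 fg; rewrite !ge0_integralE//.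
apply: le_ereal_sup => _ [h hf <-]; exists h => // x.
exact: le_trans (hf x) (fg x).
Qed.

(** * Iterated derivatives of a simple fraction *)

Section InverseDerivatives.
Variables (K : numFieldType) (a : K).

Lemma derivable_inv_sub (z : K) : z != a ->
  derivable (fun w : K => (w - a)^-1) z 1.
Proof.
move=> za; apply: derivableV; first by rewrite subr_eq0.
by apply: derivableB.
Qed.

Lemma derive1n_inv_sub n (z : K) : z != a ->
  derive1n n (fun w : K => (w - a)^-1) z = (-1) ^+ n * n`!%:R / (z - a) ^+ n.+1.
Proof.
elim: n z => [|n IH] z za; first by rewrite /= expr0 fact0 !mul1r expr1.
have z0 : z - a != 0 by rewrite subr_eq0.
pose g (w : K) : K := (w - a)^-1.
have Dsub : is_derive z (1 : K) (fun w : K => w - a) (1 : K).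
  by rewrite -[X in is_derive _ _ _ X]subr0; exact: is_deriveB.
have Dg : is_derive z (1 : K) g (- (z - a) ^- 2).
  apply: DeriveDef; first exact: derivable_inv_sub.
  by rewrite (@deriveV _ _ (fun w : K => w - a))// derive_val; exact: mulr1.
have Dgn := @is_deriveX _ _ _ n.+1 _ _ _ Dg.
rewrite derive1nS derive1E.
(* The induction hypothesis holds only off [a]; equality on a neighbourhood of [z] that avoids [a]
   is enough to differentiate it. *)
rewrite (@near_eq_derive _ _ _ _ (((-1) ^+ n * n`!%:R) *: (g ^+ n.+1))); last first.
  have : nbhs z (~` [set a]).
    apply: open_nbhs_nbhs; split; last by move=> /= /eqP; apply/negP.
    apply: closed_openC; apply: accessible_closed_set1.
    by apply: hausdorff_accessible; exact: norm_hausdorff.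
  apply: filterS => w /= /eqP wa; rewrite IH// -exprVn.
  by rewrite exprfctE.
rewrite deriveZ; last exact: ex_derive.
rewrite derive_val /g /= factS natrM [(-1) ^+ n.+1]exprS exprVn.
rewrite /GRing.scale/=.
rewrite !(exprS _ n.+1) !(exprS _ n).
field.
by rewrite z0 expf_neq0.
Qed.
End InverseDerivatives.

Lemma nneseries_le_ub (R : realType) (u : nat -> \bar R) (M : \bar R) :
  (forall n, 0 <= u n)%E ->
  (forall n, \sum_(0 <= k < n) u k <= M)%E -> (\sum_(0 <= k <oo) u k <= M)%E.
Proof.
move=> u0 uM; apply: lime_le; last exact: nearW.
by apply: is_cvg_nneseries => *; exact: u0.
Qed.

Section Construction.
Variable R : realType.
Implicit Types x y r : R.

Lemma sqr_cabs x y : cabs (x +i* y) ^+ 2 = x ^+ 2 + y ^+ 2.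
Proof. by rewrite /cabs/= sqr_sqrtr// addr_ge0// sqr_ge0. Qed.

Lemma cabs_ge0 (z : R[i]) : 0 <= cabs z.
Proof. by case: z => x y; exact: sqrtr_ge0. Qed.

Lemma cabsM (z w : R[i]) : cabs (z * w) = cabs z * cabs w.
Proof. exact: ComplexField.Normc.normcM. Qed.

Lemma cabsV (z : R[i]) : cabs z^-1 = (cabs z)^-1.
Proof. exact: ComplexField.Normc.normcV. Qed.

Lemma cabsX (z : R[i]) n : cabs (z ^+ n) = cabs z ^+ n.
Proof.
elim: n => [|n IH]; first by rewrite !expr0; exact: ComplexField.Normc.normc1.
by rewrite !exprS cabsM IH.
Qed.

Lemma cabs_nat n : cabs (n%:R : R[i]) = n%:R.
Proof. by rewrite /cabs normcMn ComplexField.Normc.normc1. Qed.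

Lemma cabs_sign n : cabs ((-1) ^+ n : R[i]) = 1.
Proof. by rewrite cabsX /cabs normcN ComplexField.Normc.normc1 expr1n. Qed.

(** * The pole and its position relative to the domain *)

Definition rho : R := (2 * Num.sqrt 2)^-1.
Definition pole : R[i] := 2^-1 +i* rho.

Lemma rho_gt0 : 0 < rho.
Proof. by rewrite invr_gt0 mulr_gt0 ?sqrtr_gt0. Qed.

Lemma sqr_rho : rho ^+ 2 = 8^-1.
Proof. by rewrite /rho exprVn exprMn sqr_sqrtr//; congr (_^-1); ring. Qed.

Lemma sqr_cabs_sub_pole x : cabs (x%:C - pole) ^+ 2 = (x - 2^-1) ^+ 2 + 8^-1.
Proof. by rewrite sqr_cabs sub0r sqrrN sqr_rho. Qed.

Definition kern (w : R[i]) : R[i] := (w - pole)^-1.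

Lemma Omega_neq_pole (z : R[i]) : Omega z -> z != pole.
Proof.
(* The hypothesis compares the squared radius [r ^+ 2 / 2] with the squared distance from [x] to
   [pole]. *)
have key x r : 0 < r ->
    r ^+ 2 <= 2 * ((x - 2^-1) ^+ 2 + 8^-1) ->
    ~ disk x%:C (r / Num.sqrt 2) pole.
  move=> r0 hr; apply/negP; rewrite -leNgt.
  rewrite -(@ler_pXn2r _ 2)// ?nnegrE ?cabs_ge0 ?divr_ge0 ?(ltW r0) ?sqrtr_ge0//.
  rewrite expr_div_n sqr_sqrtr// ler_pdivrMr//.
  rewrite -opprB /cabs normcN -/(cabs _) sqr_cabs_sub_pole; lra.
move=> Oz; apply/eqP => zp; move: Oz; rewrite zp => -[|] [x /=]; rewrite in_itv/=;
    move=> /andP[x0 x1].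
  (* For [r = x] the two sides differ by (x - 1/2)(x - 3/2), nonnegative for x <= 1/2; the other
     family is its mirror image under x -> 1 - x. *)
  by apply: key => //; nra.
by apply: key; [lra|nra].
Qed.

Lemma sqr_cabs_kern x y : cabs (kern (x +i* y)) ^+ 2 =
  ((x - 2^-1) ^+ 2 + (rho - y) ^+ 2)^-1.
Proof. by rewrite cabsV exprVn sqr_cabs -[(y - rho)]opprB sqrrN. Qed.

(** * Divergence of the area integral near the pole *)

Definition scale k : R := rho / 2 ^+ k.

Lemma scale_gt0 k : 0 < scale k.
Proof. by rewrite divr_gt0 ?rho_gt0// exprn_gt0. Qed.

Lemma scaleS k : scale k.+1 = scale k / 2.
Proof. by rewrite /scale exprS invfM mulrCA mulrC. Qed.

Lemma scale_le_rho k : scale k <= rho.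
Proof.
rewrite ler_pdivrMr ?exprn_gt0// ler_peMr//; first exact/ltW/rho_gt0.
by apply: exprn_ege1; rewrite ler1n.
Qed.

(* Disjoint boxes accumulating at pole inside the triangle |x - 1/2| < rho - y. *)
Definition tile k : set (R * R) :=
  `]2^-1 - scale k.+1, 2^-1 + scale k.+1[%classic `*`
  `]rho - scale k, rho - scale k.+1[%classic.

Lemma measurable_tile k : measurable (tile k).
Proof. by apply: measurableX; exact: measurable_itv. Qed.

Lemma area_tile k : area (tile k) = (scale k ^+ 2 / 2)%:E.
Proof.
rewrite /area product_measure1E//= !lebesgue_measure_itv/= !lte_fin.
have s0 := scale_gt0 k.
rewrite scaleS !ifT; [|lra..].
rewrite -!EFinB -EFinM; congr (_%:E); by field.
Qed.

(** The disk centred at 1/2, of radius [rho], contains the box: with v = rho - y one has |x - 1/2| <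
    v < rho, so the squared distance to the centre is below v^2 + (rho - v)^2 = rho^2 - 2v(rho -
    v). *)
Lemma tile_Omega k x y : tile k (x, y) -> Omega (x +i* y).
Proof.
rewrite /tile/= !in_itv/= => -[/andP[x1 x2] /andP[y1 y2]]; left.
exists 2^-1; first by rewrite /= in_itv/= lexx andbT.
have r0 := rho_gt0.
rewrite /disk/= -invfM -/rho -(@ltr_pXn2r _ 2)// ?nnegrE ?cabs_ge0 ?(ltW r0)//.
rewrite sqr_cabs.
have sr := scale_le_rho k. have s0 := scale_gt0 k.+1.
have u2 : (x - 2^-1) ^+ 2 < scale k.+1 ^+ 2 by nra.
have v2 : scale k.+1 ^+ 2 < (rho - y) ^+ 2 by nra.
by rewrite subr0; nra.
Qed.

(** The squared distance to [pole] is less than (1/4 + 1) [scale k ^+ 2]. The rounder constant 2,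
    against the area [scale k ^+ 2 / 2], makes every box contribute exactly 1/4 to the minorant. *)
Lemma tile_kern k x y : tile k (x, y) ->
  (2 * scale k ^+ 2)^-1 <= cabs (kern (x +i* y)) ^+ 2.
Proof.
rewrite /tile/= !in_itv/= sqr_cabs_kern => -[/andP[x1 x2] /andP[y1 y2]].
have s0 := scale_gt0 k.+1.
have sE := scaleS k.
have u2 : (x - 2^-1) ^+ 2 < scale k.+1 ^+ 2 by nra.
have v1 : scale k.+1 ^+ 2 < (rho - y) ^+ 2 by nra.
have v2 : (rho - y) ^+ 2 < scale k ^+ 2 by nra.
rewrite lef_pV2 ?posrE; nra.
Qed.

Definition staircase n (p : R * R) : R :=
  \sum_(k < n) (2 * scale k ^+ 2)^-1 * \1_(tile k) p.

Definition restricted_sqr_kern (p : R * R) : R :=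
  if p \in [set p : R * R | Omega (p.1 +i* p.2)]
  then cabs (kern (p.1 +i* p.2)) ^+ 2 else 0.

(* The second conjunct strengthens the induction: below height rho - scale n lie
   all earlier tiles, so at most one term of the sum is nonzero at each p. *)
Lemma staircase_le n p : staircase n p <= restricted_sqr_kern p /\
  (rho - scale n <= p.2 -> staircase n p = 0).
Proof.
case: p => x y; rewrite /restricted_sqr_kern/=.
elim: n => [|n [IH1 IH2]].
  by rewrite /staircase big_ord0; split => //; case: ifP => // _; exact: sqr_ge0.
rewrite /staircase big_ord_recr/= -/(staircase n (x, y)) indicE.
have sE := scaleS n. have s0 := scale_gt0 n.
have [/set_mem xyn|xyn] := boolP ((x, y) \in tile n).
  have := xyn; rewrite /tile/= !in_itv/= => -[_ /andP[y1 y2]]; split; last by lra.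
  rewrite IH2 ?(ltW y1)// add0r mulr1 mem_set; last exact: (tile_Omega xyn).
  exact: tile_kern.
rewrite mulr0 addr0; split => // yn; apply: IH2; lra.
Qed.

Lemma integral_staircase n : (\int[@area R]_p (staircase n p)%:E = (n%:R / 4)%:E)%E.
Proof.
rewrite /staircase.
under eq_integral do rewrite -sumEFin.
rewrite ge0_integral_sum//; last 2 first.
- move=> k; apply/measurable_EFinP; apply: measurable_funM => //.
  apply: measurable_indic; exact: measurable_tile.
- by move=> k p _; rewrite lee_fin mulr_ge0// invr_ge0 mulr_ge0// sqr_ge0.
rewrite (eq_bigr (fun=> (4^-1)%:E)) => [|k _].
  by rewrite sumEFin sumr_const card_ord mulr_natl.
under eq_integral do rewrite EFinM.
rewrite ge0_integralZl//; last first.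
- by rewrite lee_fin invr_ge0 mulr_ge0// sqr_ge0.
- by apply/measurable_EFinP; apply: measurable_indic; exact: measurable_tile.
rewrite integral_indic//; last exact: measurable_tile.
rewrite setIT [X in (_ * X)%E]area_tile -EFinM; congr (_%:E).
by field; rewrite lt0r_neq0// scale_gt0.
Qed.

Lemma kern_not_bergman : ~ bergman_space (@Omega R) kern.
Proof.
move=> [_]; set I := (\int[_]_(_ in _) _)%E => Ioo.
have In n : ((n%:R / 4)%:E <= I)%E.
  rewrite -integral_staircase; apply: ge0_le_integral_nonmeasurable.
  - move=> p _; rewrite lee_fin; apply: sumr_ge0 => k _.
    by rewrite mulr_ge0// invr_ge0 mulr_ge0// sqr_ge0.
  - by move=> p _; rewrite lee_fin sqr_ge0.
  - move=> p; rewrite patch_setT /patch.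
    have [+ _] := staircase_le n p; rewrite /restricted_sqr_kern.
    by case: ifP => _; rewrite lee_fin.
have I0 : (0 <= I)%E by have := In 0%N; rewrite mul0r.
have If : I \is a fin_num by rewrite ge0_fin_numE.
(* An integer n exceeding 4I contradicts n/4 <= I. *)
have := In (Num.truncn (4 * fine I)).+1.
rewrite -(fineK If) lee_fin leNgt => /negP; apply.
rewrite ltr_pdivlMr// mulrC; exact: truncnS_gt.
Qed.

(** * Convergence of the series *)

Definition weight n : R := 4 ^+ n * n`!%:R ^+ 2 / (2 * n + 1)`!%:R.

Lemma weight_ge0 n : 0 <= weight n.
Proof. by rewrite divr_ge0// mulr_ge0// exprn_ge0. Qed.

(** Consecutive weights have ratio (2n+2)/(2n+3): [weight n] is the Wallis integral of sin^(2n+1)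
    over [0, pi/2]. *)
Lemma weightB n : weight n - weight n.+1 = weight n / (2 * n + 3)%:R.
Proof.
have f0 : (2 * n + 1)`!%:R != 0 :> R by rewrite pnatr_eq0 -lt0n fact_gt0.
rewrite /weight (_ : 2 * n.+1 + 1 = (2 * n + 1).+2)%N; last by lia.
rewrite !factS !natrM exprS -[(2 * n + 1).+2]addn2 -[(2 * n + 1).+1]addn1.
rewrite !natrD ![in LHS]exprS !expr1 ?natrM -[n.+1]addn1 natrD.
have n0 : 0 <= n%:R :> R by [].
field.
by rewrite f0 !lt0r_neq0//; lra.
Qed.

Lemma continuous_shiftX n : continuous (fun x : R => (2^-1 + x) ^+ n).
Proof.
move=> x; apply: (@continuous_comp _ _ _ (fun x => 2^-1 + x) (@GRing.exp R ^~ n)).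
  by apply: cvgD; [exact: cvg_cst|exact: cvg_id].
exact: exprn_continuous.
Qed.

Lemma integral_geometric n :
  (\int[@lebesgue_measure R]_(x in `]0%R, 2^-1%R]) ((2^-1 + x) ^+ n)%:E <=
   (n.+1%:R^-1)%:E)%E.
Proof.
pose g (x : R) : R := 2^-1 + x.
pose G : R -> R := n.+1%:R^-1 *: g ^+ n.+1.
have GE x : G x = n.+1%:R^-1 * g x ^+ n.+1 by rewrite /G exprfctE.
have DG x : is_derive x (1 : R) G (g x ^+ n).
  have Dg : is_derive x (1 : R) g (1 : R).
    by rewrite -[X in is_derive _ _ _ X]add0r; exact: is_deriveD.
  have := @is_deriveZ _ _ _ _ n.+1%:R^-1 _ _ _ (@is_deriveX _ _ _ n.+1 _ _ _ Dg).
  by rewrite /GRing.scale/= mulr1 mulKf.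
have cG : continuous G.
  move=> x; rewrite /continuous_at (funext GE); apply: cvgM.
    exact: cvg_cst.
  exact: (@continuous_shiftX n.+1 x).
rewrite integral_itv_obnd_cbnd; last first.
  apply/measurable_EFinP/measurable_funTS.
  by apply: continuous_measurable_fun; exact: continuous_shiftX.
rewrite (@continuous_FTC2 _ _ G) //.
(* The base equals 1 at the upper endpoint; the nonnegative term from the lower endpoint is
   dropped. *)
- rewrite -EFinB lee_fin !GE -mulrBr /g addr0 (_ : 2^-1 + 2^-1 = 1); last by field.
  by rewrite expr1n ler_piMr ?invr_ge0// lerBlDr lerDl exprn_ge0.
- by apply: continuous_subspaceT; exact: continuous_shiftX.
- split => [x _| |]; first exact: ex_derive.
  + by apply: cvg_at_right_filter; exact: cG.
  + by apply: cvg_at_left_filter; exact: cG.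
- by move=> x _; rewrite derive1E derive_val.
Qed.

Lemma sqr_cabs_derive1n_kern n x :
  cabs (derive1n n kern x%:C) ^+ 2 = n`!%:R ^+ 2 / ((x - 2^-1) ^+ 2 + 8^-1) ^+ n.+1.
Proof.
have xp : x%:C != pole.
  apply/eqP => /(congr1 (@complex.Im R))/= /eqP.
  by rewrite eq_sym gt_eqF// rho_gt0.
rewrite (@derive1n_inv_sub R[i] pole)// cabsM cabsV cabsX cabsM cabs_sign mul1r cabs_nat.
by rewrite exprMn exprVn -exprM mulnC exprM sqr_cabs_sub_pole.
Qed.

Lemma term_bound n x : 0 < x <= 2^-1 ->
  2 ^+ n / (2 * n + 1)`!%:R * (x ^+ (2 * n + 1) *
     (cabs (derive1n n kern x%:C) ^+ 2 + cabs (derive1n n kern (1 - x)%:C) ^+ 2))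
  <= 8 * weight n * (2^-1 + x) ^+ n.
Proof.
move=> /andP[x0 x1].
rewrite !sqr_cabs_derive1n_kern.
(* The points x and 1 - x are equidistant from [pole], so both derivatives share the denominator
   [D]. *)
rewrite (_ : 1 - x - 2^-1 = - (x - 2^-1)); last by field.
rewrite sqrrN.
set D := _ + 8^-1.
have D8 : 8^-1 <= D by rewrite lerDr sqr_ge0.
have D0 : 0 < D by apply: lt_le_trans D8.
have f0 : (2 * n + 1)`!%:R != 0 :> R by rewrite pnatr_eq0 -lt0n fact_gt0.
have q1 : x ^+ 2 / (2 * D) <= 2^-1 + x.
  (* This product is the factored form of (1/2 + x) 2D - x^2. *)
  have : 0 <= (2^-1 - x) * (3 / 4 + x - 2 * x ^+ 2) by apply: mulr_ge0; nra.
  by rewrite ler_pdivrMr ?mulr_gt0// /D; lra.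
have -> : 2 ^+ n / (2 * n + 1)`!%:R *
    (x ^+ (2 * n + 1) * (n`!%:R ^+ 2 / D ^+ n.+1 + n`!%:R ^+ 2 / D ^+ n.+1)) =
    weight n * (x ^+ 2 / (2 * D)) ^+ n * (2 * x / D).
  rewrite /weight exprD exprM expr1 (exprS D) (_ : 4 = 2 * 2 :> R); last by ring.
  rewrite expr_div_n !exprMn.
  field.
  by rewrite f0 lt0r_neq0// !expf_neq0// lt0r_neq0.
(* Here 2x <= 1 <= 8D. *)
have q2 : 2 * x / D <= 8 by rewrite ler_pdivrMr//; lra.
have q0 : 0 <= x ^+ 2 / (2 * D) by rewrite divr_ge0 ?sqr_ge0// mulr_ge0// ltW.
have w0 := weight_ge0 n.
rewrite mulrC mulrA ler_pM//.
- by rewrite mulr_ge0// divr_ge0 ?(ltW D0)// mulr_ge0// ltW.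
- by rewrite exprn_ge0.
- by rewrite ler_wpM2r.
- by rewrite lerXn2r// nnegrE; lra.
Qed.

Lemma weight_sum n : \sum_(0 <= k < n) weight k / (2 * k + 3)%:R <= 1.
Proof.
under eq_bigr do rewrite -weightB.
rewrite -[X in X <= _]opprK -sumrN.
under eq_bigr do rewrite opprB.
(* The sum collapses to [weight 0 - weight n], and [weight 0 = 1]. *)
rewrite telescope_sumr// opprB {1}/weight expr0 fact0 expr1n mulr1 divr1.
by rewrite gerBl weight_ge0.
Qed.

Lemma integral_bound n :
  ((2 ^+ n / (2 * n + 1)`!%:R : R)%:E *
     \int[@lebesgue_measure R]_(x in `]0%R, (2^-1)%R])
       (x ^+ (2 * n + 1) *
         (cabs (derive1n n kern x%:C) ^+ 2 + cabs (derive1n n kern (1 - x)%:C) ^+ 2))%:E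
   <= (24 * (weight n / (2 * n + 3)%:R))%:E)%E.
Proof.
set c : R := 2 ^+ n / _.
have c0 : 0 < c by rewrite divr_gt0 ?exprn_gt0// ltr0n fact_gt0.
have w0 := weight_ge0 n.
pose b x : R := (2^-1 + x) ^+ n.
(* Dividing by the prefactor [c] turns [term_bound] into a bound on the integrand alone. *)
pose C := 8 * weight n / c.
have C0 : 0 <= C by rewrite divr_ge0 ?(ltW c0)// mulr_ge0.
have b0 x : 0 < x <= 2^-1 -> 0 <= b x by move=> /andP[x0 _]; rewrite exprn_ge0//; lra.
apply: (@le_trans _ _ (c%:E *
  \int[@lebesgue_measure R]_(x in `]0%R, (2^-1)%R]) (C%:E * (b x)%:E))%E).
  apply: lee_wpmul2l; first by rewrite lee_fin ltW.
  apply: ge0_le_integral_nonmeasurable => x.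
  - rewrite /= in_itv/= => /andP[x0 _]; rewrite lee_fin mulr_ge0 ?exprn_ge0 ?(ltW x0)//.
    by rewrite addr_ge0 ?sqr_ge0.
  - by rewrite /= in_itv/= => /b0 bx; rewrite -EFinM lee_fin mulr_ge0.
  - rewrite /patch; case: ifPn => // /set_mem/=; rewrite in_itv/= => hx.
    rewrite -EFinM lee_fin /C mulrAC ler_pdivlMr// mulrC; exact: term_bound.
rewrite ge0_integralZl//; last first.
- apply/measurable_EFinP/measurable_funTS; apply: continuous_measurable_fun.
  exact: continuous_shiftX.
rewrite muleA -EFinM.
have -> : c * C = 8 * weight n by rewrite /C mulrC divfK// lt0r_neq0.
apply: (@le_trans _ _ ((8 * weight n)%:E * (n.+1%:R^-1)%:E)%E).
  by apply: lee_wpmul2l; [rewrite lee_fin mulr_ge0|exact: integral_geometric].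
rewrite -EFinM lee_fin.
have n1 : 0 < n.+1%:R :> R by [].
(* Since 2n + 3 <= 3(n + 1), the factor 1/(n + 1) is at most 3/(2n + 3), which is the telescoping
   form. *)
rewrite -mulrA (_ : 24 = 8 * 3); last by ring.
rewrite -mulrA ler_wpM2l// mulrCA ler_wpM2l// ler_pdivlMr; last by rewrite ltr0n addn3.
by rewrite mulrC ler_pdivrMr// -natrM ler_nat; lia.
Qed.

End Construction.

Theorem proposition3p2 (R : realType) :
  exists f : R[i] -> R[i],
    [/\ holomorphic_on (@Omega R) f,
        ~ bergman_space (@Omega R) f &
        (\sum_(0 <= n <oo)
           (2 ^+ n / (2 * n + 1)`!%:R : R)%:E *
           \int[@lebesgue_measure R]_(x in `]0%R, (2^-1)%R])
             (x ^+ (2 * n + 1) *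
               (cabs (derive1n n f x%:C) ^+ 2 +
                cabs (derive1n n f (1 - x)%:C) ^+ 2))%:E < +oo)%E].
Proof.
exists (@kern R); split; [|exact: kern_not_bergman|].
  by move=> z /Omega_neq_pole zp; exact: (@derivable_inv_sub R[i]).
apply: (@le_lt_trans _ _ 24%:E); last exact: ltry.
apply: nneseries_le_ub => n.
  rewrite mule_ge0// ?lee_fin ?divr_ge0 ?exprn_ge0//.
  apply: integral_ge0 => x; rewrite /= in_itv/= => /andP[x0 _]; rewrite lee_fin.
  by rewrite mulr_ge0 ?exprn_ge0 ?(ltW x0)// addr_ge0 ?sqr_ge0.
apply: le_trans (lee_sum _ (fun k _ => integral_bound R k)) _.
by rewrite sumEFin lee_fin -mulr_sumr ler_piMr// weight_sum.
Qed.
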